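(* (1) $\mathfrak{rr} \leq \max\{\text{\ss},\mathfrak{b}\}$. (2) $\mathfrak{rr}_i \leq \max\{\text{\ss}_i,\mathfrak{d}\}$.
   Context: $\mathbb{N}=\{1,2,3,\dots\}$. For $A\subseteq\mathbb{N}$, the subseries $\sum_{n\in A}a_n$ is summed in increasing order of the indices; if $A$ is finite it counts as convergent. A series is conditionally convergent if it converges but not absolutely. The subseries number $\text{\ss}$ is the smallest cardinality of a family $\mathcal{A}$ of subsets of $\mathbb{N}$ such that for every conditionally convergent series $\sum_{n\in\mathbb{N}}a_n$ of real numbers there is $A\in\mathcal{A}$ such that $\sum_{n\in A}a_n$ diverges. $\text{\ss}_i$ is defined in the same way, except that $\sum_{n\in A}a_n$ is required to diverge to $+\infty$ or to $-\infty$. The rearrangement number $\mathfrak{rr}$ is the smallest cardinality of a family $\mathcal{C}$ of permutations of $\mathbb{N}$ such that for every conditionally convergent series $\sum_n a_n$ of real numbers there is $p\in\mathcal{C}$ for which the rearrangement $\sum_n a_{p(n)}$ no longer converges to the same limit (i.e. it either diverges or converges to a different value). $\mathfrak{rr}_i$ is defined like $\mathfrak{rr}$ except that $\sum_n a_{p(n)}$ is required to diverge to $+\infty$ or to $-\infty$. For $f,g:\mathbb{N}\to\mathbb{N}$, $f\leq^* g$ means $f(n)\leq g(n)$ for all but finitely many $n$. The bounding number $\mathfrak{b}$ is the minimum cardinality of a family $\mathcal{B}$ of functions $\mathbb{N}\to\mathbb{N}$ such that no single $g:\mathbb{N}\to\mathbb{N}$ satisfies $f\leq^* g$ for all $f\in\mathcal{B}$.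 The dominating number $\mathfrak{d}$ is the minimum cardinality of a family $\mathcal{D}$ of functions $\mathbb{N}\to\mathbb{N}$ such that every $g:\mathbb{N}\to\mathbb{N}$ satisfies $g\leq^* f$ for some $f\in\mathcal{D}$. *)

(* Defs.v *)
From HB Require Import structures.
From mathcomp Require Import all_boot all_order all_algebra.
From mathcomp Require Import all_classical all_reals all_analysis.
Import Order.TTheory GRing.Theory Num.Theory.
Import numFieldNormedType.Exports.

Set Implicit Arguments.
Unset Strict Implicit.
Unset Printing Implicit Defensive.

Local Open Scope classical_set_scope.
Local Open Scope card_scope.

(* A cardinal is an equipotence class of types, i.e. a value of the form
   [cardinal_of A]. *)
Definition cardinal := set Type.

Definition cardinal_of (T : Type) (A : set T) : cardinal :=
  [set U : Type | A #= [set: U]].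

Definition cardinal_le (k l : cardinal) : Prop :=
  exists T U : Type, [/\ k T, l U & [set: T] #<= [set: U]].

Definition cardinal_max (k l : cardinal) : cardinal :=
  if `[< cardinal_le k l >] then l else k.

(* The smallest cardinality of a family satisfying [P]; it is attained by
   [min_cardP] below. If no family satisfies [P], it is [set0], which is not a
   cardinal and is not [cardinal_le]-comparable to anything. *)
Definition min_card (T : Type) (P : set (set T)) : cardinal :=
  xget set0
    [set k | (exists2 A, P A & k = cardinal_of A) /\
             forall B, P B -> cardinal_le k (cardinal_of B)].

Lemma cardinal_leE (T U : Type) (A : set T) (B : set U) :
  cardinal_le (cardinal_of A) (cardinal_of B) <-> A #<= B.
Proof.
split=> [[X [Y [/= AX BY XY]]]|AB].
  by rewrite (card_le_eql AX) (card_le_eqr BY).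
exists {x | A x}, {x | B x}.
have sE V (C : set V) : C #= [set: {x | C x}].
  have CE : C = @proj1_sig V C @` [set: {x | C x}].
    apply/seteqP; split=> [x Cx|_ [[x Cx] _ <-] //].
    by exists (exist _ x Cx).
  rewrite [X in X #= _]CE; apply: inj_card_eq => -[x Cx] [y Cy] _ _ /= xy.
  exact: eq_exist.
split; [exact: sE | exact: sE |].
by rewrite -(card_le_eql (sE _ A)) -(card_le_eqr (sE _ B)).
Qed.

Lemma exists_card_le_min (T : Type) (P : set (set T)) : P !=set0 ->
  exists2 A, P A & forall B, P B -> A #<= B.
Proof.
move=> [A0 PA0].
pose I := {A : set T | P A}.
pose Q (S : set (I -> T)) := (forall x, S x -> forall i, sval i (x i)) /\
  (forall i x y, S x -> S y -> x i = y i -> x = y).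
have [F FQ totF|S [[SI Sinj] Smax]] := @Zorn_bigcup (I -> T) Q.
  split=> [x [X FX Xx]|i x y [X FX Xx] [Y FY Yy]].
    by have [XI _] := FQ _ FX; exact: XI.
  have [XY|YX] := totF _ _ FX FY.
    by have [_ inj] := FQ _ FY; exact: inj (XY _ Xx) Yy.
  by have [_ inj] := FQ _ FX; exact: inj Xx (YX _ Yy).
have [i iS] : exists i, sval i `<=` [set x i | x in S].
  apply: contrapT => /forallNP nS.
  have /choice[y yP] (i : I) : exists t, sval i t /\ ~ [set x i | x in S] t.
    by have /existsNP[t /not_implyP] := nS i; exists t.
  apply: (Smax (S `|` [set y])).
    split; first by left.
    move=> /(_ y (or_intror erefl)) Sy.
    by have [_] := yP (exist _ A0 PA0); apply; exists y.
  split=> [x [Sx|->] i|i x z [Sx|->] [Sz|->] // xz].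
  - exact: SI.
  - by have [] := yP i.
  - exact: Sinj xz.
  - by have [_ []] := yP i; exists x.
  - by have [_ []] := yP i; exists z.
exists (sval i); first exact: (svalP i).
move=> B PB; pose j : I := exist _ B PB.
apply: card_le_trans (subset_card_le iS) _.
apply: card_le_trans (card_image_le _ _) _.
have Sj : {in S &, injective (fun x : I -> T => x j)}.
  by move=> x y /set_mem Sx /set_mem Sy; exact: Sinj.
rewrite -(card_le_eql (inj_card_eq Sj)).
by apply: subset_card_le => _ [x Sx <-]; exact: (SI x Sx j).
Qed.

Lemma min_cardP (T : Type) (P : set (set T)) : P !=set0 ->
  exists A, [/\ P A, min_card P = cardinal_of A & forall B, P B -> A #<= B].
Proof.
move=> /exists_card_le_min[A PA Amin].
have : exists k, (exists2 A, P A & k = cardinal_of A) /\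
    forall B, P B -> cardinal_le k (cardinal_of B).
  exists (cardinal_of A); split; first by exists A.
  by move=> B PB; apply/cardinal_leE; exact: Amin.
move=> /(xgetPex set0)[[C PC CE] Cmin].
exists C; split=> // B PB; apply/cardinal_leE.
by rewrite -CE; exact: Cmin.
Qed.

Section series.
Variable R : realType.
Implicit Types (a : R^nat) (A : set nat) (p : nat -> nat).
Local Open Scope ring_scope.

Definition cond_cvg a : Prop :=
  cvgn (series a) /\ ~ cvgn [normed series a].

Definition dvg_infty (u : R^nat) : Prop :=
  (u @ \oo --> +oo) \/ (u @ \oo --> -oo).

Definition increasing_enum (e : nat -> nat) A : Prop :=
  {homo e : m n / (m < n)%N} /\ range e = A.

(* An increasing enumeration by [nat] exists (and is unique) exactly when [A]
   is infinite, so a subseries over a finite set never diverges. *)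
Definition subseries_dvg a A : Prop :=
  exists2 e, increasing_enum e A & ~ cvgn (series (a \o e)).

Definition subseries_dvg_infty a A : Prop :=
  exists2 e, increasing_enum e A & dvg_infty (series (a \o e)).

Definition subseries_family (F : set (set nat)) : Prop :=
  forall a, cond_cvg a -> exists2 A, F A & subseries_dvg a A.

Definition subseries_infty_family (F : set (set nat)) : Prop :=
  forall a, cond_cvg a -> exists2 A, F A & subseries_dvg_infty a A.

Definition rearrangement_family (C : set (nat -> nat)) : Prop :=
  (forall p, C p -> bijective p) /\
  forall a, cond_cvg a ->
    exists2 p, C p & ~ (series (a \o p) @ \oo --> limn (series a)).

Definition rearrangement_infty_family (C : set (nat -> nat)) : Prop :=
  (forall p, C p -> bijective p) /\
  forall a, cond_cvg a -> exists2 p, C p & dvg_infty (series (a \o p)).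

End series.

Definition le_star (f g : nat -> nat) : Prop :=
  finite_set [set n | ~ (f n <= g n)%N].

Definition unbounded_family (B : set (nat -> nat)) : Prop :=
  ~ exists g, forall f, B f -> le_star f g.

Definition dominating_family (D : set (nat -> nat)) : Prop :=
  forall g, exists2 f, D f & le_star g f.

Definition subseries_number (R : realType) : cardinal :=
  min_card (@subseries_family R).

Definition subseries_number_infty (R : realType) : cardinal :=
  min_card (@subseries_infty_family R).

Definition rearrangement_number (R : realType) : cardinal :=
  min_card (@rearrangement_family R).

Definition rearrangement_number_infty (R : realType) : cardinal :=
  min_card (@rearrangement_infty_family R).

Definition bounding_number : cardinal := min_card unbounded_family.

Definition dominating_number : cardinal := min_card dominating_family.

(* Main.v *)
(* For a set [A] and a function [f], keep the elements of [A] in increasing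
   order and postpone the [n]-th natural number, if outside [A], to the point
   [i_n] of a sequence of checkpoints that grows faster than [f]. This gives a
   permutation [p_(A,f)].

   If the subseries over [A] is not Cauchy, every [m] is the left end of an
   interval [m, g m) on which it oscillates by a fixed amount. When [f] is not
   dominated by [g \o g], infinitely many such intervals lie between two
   consecutive checkpoints, where [p_(A,f)] lists only elements of [A]; so the
   rearrangement by [p_(A,f)] is not Cauchy either.

   If the subseries over [A] tends to infinity and [f] grows fast enough, then
   the terms outside [A] come so late that they cannot prevent the rearrangement
   by [p_(A,f)] from tending to infinity.

   Since unbounded families are infinite, the number of pairs [(A, f)] is the
   maximum of the two cardinals; this is the theorem that [k * k = k] for an
   infinite cardinal [k]. *)
Require Import Defs.
From mathcomp Require Import all_boot all_order all_algebra.
From mathcomp Require Import all_classical all_reals all_analysis.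
From mathcomp Require Import zify lra.
Import Order.TTheory GRing.Theory Num.Theory.
Import numFieldNormedType.Exports.

Set Implicit Arguments.
Unset Strict Implicit.
Unset Printing Implicit Defensive.

Local Open Scope classical_set_scope.
Local Open Scope card_scope.

(** * Squares of infinite cardinals *)

Lemma card_le_inj (T U : Type) (A : set T) (B : set U) (f : T -> U) :
  (forall x, A x -> B (f x)) ->
  (forall x y, A x -> A y -> f x = f y -> x = y) -> A #<= B.
Proof.
move=> fAB fI.
have fI' : {in A &, injective f}.
  by move=> x y /set_mem Ax /set_mem Ay; exact: fI.
rewrite -(card_le_eql (inj_card_eq fI')).
by apply: subset_card_le => _ [x Ax <-]; exact: fAB.
Qed.

Lemma card_le_injP (T U : Type) (A : set T) (B : set U) : B !=set0 ->
  A #<= B -> exists f : T -> U, (forall x, A x -> B (f x)) /\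
    (forall x y, A x -> A y -> f x = f y -> x = y).
Proof.
elim/Ppointed: U => U in B *; first by move=> [x]; rewrite emptyE.
move=> _ /pcard_leP[f]; exists f; split=> [x Ax|x y Ax Ay].
  exact: funS.
by apply: inj; rewrite inE.
Qed.

(** Tagged copies of the two sets live in one sum type, and a member of least cardinality of that
    two-element family is the smaller one. *)
Lemma card_le_total (T U : Type) (A : set T) (B : set U) : A #<= B \/ B #<= A.
Proof.
have inlA : @inl T U @` A #= A by apply: inj_card_eq => x y _ _ [].
have inrB : @inr T U @` B #= B by apply: inj_card_eq => x y _ _ [].
pose P : set (set (T + U)) := [set inl @` A; inr @` B].
have [|C PC Cmin] := @exists_card_le_min _ P.
  by exists (inl @` A); left.
case: PC Cmin => -> Cmin.
  left; rewrite -(card_le_eql inlA) -(card_le_eqr inrB).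
  by apply: Cmin; right.
right; rewrite -(card_le_eqr inlA) -(card_le_eql inrB).
by apply: Cmin; left.
Qed.

Definition graph_dom (T : Type) (S : set (T * T * T)) : set T :=
  [set x | exists z, S (x, x, z)].

(* [S] is the graph of an injection of [X `*` X] into [X], for some [X `<=` A],
   which is then [graph_dom S]. *)
Definition is_pairing (T : Type) (A : set T) (S : set (T * T * T)) : Prop :=
  let X := graph_dom S in
  [/\ X `<=` A, forall x y z, S (x, y, z) -> [/\ X x, X y & X z],
      forall x y, X x -> X y -> exists z, S (x, y, z),
      forall x y z z', S (x, y, z) -> S (x, y, z') -> z = z' &
      forall x y x' y' z, S (x, y, z) -> S (x', y', z) -> x = x' /\ y = y'].

(** Pairings arise from an injective parametrization of the domain: by [nat] for the initial one, by
    two tagged copies of the old domain for an extension. *)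
Lemma is_pairing_graph (T I : Type) (A : set T) (X : set I) (g : I -> T)
    (F : I -> I -> T) :
  (forall i, X i -> A (g i)) ->
  (forall i j, X i -> X j -> g i = g j -> i = j) ->
  (forall i j, X i -> X j -> exists2 k, X k & F i j = g k) ->
  (forall i j i' j', X i -> X j -> X i' -> X j' -> F i j = F i' j' ->
     i = i' /\ j = j') ->
  let S := [set t | exists i j, [/\ X i, X j & t = (g i, g j, F i j)]] in
  is_pairing A S /\ graph_dom S = g @` X.
Proof.
move=> gA gI FX FI S.
have domS : graph_dom S = g @` X.
  apply/seteqP; split=> [x [z [i [j [Xi Xj [-> _ _]]]]]|_ [i Xi <-]].
    by exists i.
  by exists (F i i), i, i.
split=> //; split; rewrite /= ?domS.
- by move=> _ [i Xi <-]; exact: gA.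
- move=> x y z [i [j [Xi Xj [-> -> ->]]]]; split; [by exists i|by exists j|].
  by have [k Xk ->] := FX i j Xi Xj; exists k.
- by move=> _ _ [i Xi <-] [j Xj <-]; exists (F i j), i, j.
- move=> x y z z' [i [j [Xi Xj [-> -> ->]]]] [i' [j' [Xi' Xj']]].
  by move=> [/gI <- // /gI <- // ->].
- move=> x y x' y' z [i [j [Xi Xj [-> -> ->]]]] [i' [j' [Xi' Xj']]].
  by move=> [-> ->] /FI [] // -> ->.
Qed.

(** Any two triples of the union lie in a single pairing below it, and no clause of [is_pairing]
    assumes more than two triples. *)
Lemma is_pairing_bigcup (T : Type) (A : set T) (S0 : set (T * T * T))
    (F : set (set (T * T * T))) :
  is_pairing A S0 -> (forall S, F S -> is_pairing A (S `|` S0)) ->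
  total_on F subset -> is_pairing A ((\bigcup_(S in F) S) `|` S0).
Proof.
move=> pS0 pF Ftot; set U := _ `|` S0.
have common t u : U t -> U u ->
    exists V, [/\ is_pairing A V, V `<=` U, V t & V u].
  have sub S : F S -> S `|` S0 `<=` U.
    by move=> FS v [Sv|S0v]; [left; exists S|right].
  move=> [[S FS St]|S0t] [[S' FS' Su]|S0u].
  - have [SS'|S'S] := Ftot _ _ FS FS'.
      exists (S' `|` S0); split; [exact: pF|exact: sub| |by left].
      by left; exact: SS'.
    exists (S `|` S0); split; [exact: pF|exact: sub|by left|].
    by left; exact: S'S.
  - exists (S `|` S0).
    by split; [exact: pF|exact: sub|left|right].
  - exists (S' `|` S0).
    by split; [exact: pF|exact: sub|right|left].
  - by exists S0; split=> // v; right.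
have domU V x : V `<=` U -> graph_dom V x -> graph_dom U x.
  by move=> VU [z Vz]; exists z; exact: VU.
split.
- move=> x [z Uz]; have [V [[VA _ _ _ _] _ Vz _]] := common _ _ Uz Uz.
  by apply: VA; exists z.
- move=> x y z Uz; have [V [[_ VX _ _ _] VU Vz _]] := common _ _ Uz Uz.
  by have [? ? ?] := VX _ _ _ Vz; split; exact: domU VU _.
- move=> x y [z Uz] [w Uw].
  have [V [[_ _ Vt _ _] VU Vz Vw]] := common _ _ Uz Uw.
  have [v Vv] := Vt x y (ex_intro _ z Vz) (ex_intro _ w Vw).
  by exists v; exact: VU.
- move=> x y z z' Uz Uz'.
  by have [V [[_ _ _ Vf _] _ Vz Vz']] := common _ _ Uz Uz'; exact: Vf Vz Vz'.
- move=> x y x' y' z Uz Uz'.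
  by have [V [[_ _ _ _ VI] _ Vz Vz']] := common _ _ Uz Uz'; exact: VI Vz Vz'.
Qed.

(* Tagging splits [X `|` h @` X] into two copies of [X]; the pairs involving
   [h @` X] form three copies of [X `*` X], which are coded into [h @` X]. *)
Lemma pairing_extend (T : Type) (A : set T) (S : set (T * T * T))
    (n : nat -> T) (h : T -> T) :
  let X := graph_dom S in
  is_pairing A S -> injective n -> (forall i, X (n i)) ->
  (forall x, X x -> (A `\` X) (h x)) ->
  (forall x y, X x -> X y -> h x = h y -> x = y) ->
  exists2 S', is_pairing A S' & S `<` S'.
Proof.
move=> X [SA SX St Sf SI] nI nX hX hI.
have [F FS] : exists F : T -> T -> T,
    forall x y, X x -> X y -> S (x, y, F x y).
  have /choice[F FP] (t : T * T) : exists z, X t.1 -> X t.2 -> S (t.1, t.2, z).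
    have [[Xx Xy]|nXX] := pselect (X t.1 /\ X t.2).
      by have [z Sz] := St _ _ Xx Xy; exists z.
    by exists (n 0) => Xx Xy; case: nXX.
  by exists (fun x y => F (x, y)) => x y Xx Xy; exact: (FP (x, y)).
have FX x y : X x -> X y -> X (F x y).
  by move=> Xx Xy; have [] := SX _ _ _ (FS x y Xx Xy).
have FI x y x' y' : X x -> X y -> X x' -> X y' -> F x y = F x' y' ->
    x = x' /\ y = y'.
  move=> Xx Xy Xx' Xy' E; apply: SI (FS _ _ Xx Xy) _.
  by rewrite E; exact: FS.
pose XX : set (bool * T) := [set i | X i.2].
pose g (i : bool * T) := if i.1 then h i.2 else i.2.
(* The number [i.1 + j.1.*2] identifies the pair of tags and is coded by [n]. Untagged pairs keep
   their value, so the new graph contains [S]. *)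
pose G (i j : bool * T) := if i.1 || j.1
  then h (F (F i.2 j.2) (n (i.1 + j.1.*2)%N)) else F i.2 j.2.
have gI i j : XX i -> XX j -> g i = g j -> i = j.
  case: i j => [[] x] [[] y]; rewrite /XX /g /= => Xx Xy E.
  - by rewrite (hI _ _ Xx Xy E).
  - by have [_] := hX x Xx; rewrite E.
  - by have [_] := hX y Xy; rewrite -E.
  - by rewrite E.
have Gg i j : XX i -> XX j ->
    G i j = g (i.1 || j.1, if i.1 || j.1
      then F (F i.2 j.2) (n (i.1 + j.1.*2)%N) else F i.2 j.2).
  by rewrite /G /g /=; case: ifP.
have GX i j : XX i -> XX j -> XX (i.1 || j.1, if i.1 || j.1
      then F (F i.2 j.2) (n (i.1 + j.1.*2)%N) else F i.2 j.2).
  by rewrite /XX /= => Xi Xj; case: ifP => _; do ?[exact: nX|apply: (FX)].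
have [|||S'P domS'] := @is_pairing_graph T (bool * T) A XX g G _ gI _ _.
- move=> [[] x]; rewrite /XX /g /= => Xx; last exact: SA.
  by have [] := hX x Xx.
- move=> i j XXi XXj; rewrite Gg //.
  exact: (ex_intro2 _ _ _ (GX _ _ XXi XXj) erefl).
- move=> i j i' j' Xi Xj Xi' Xj'; rewrite !Gg //.
  move=> /(gI _ _ (GX _ _ Xi Xj) (GX _ _ Xi' Xj')) [E].
  case: i j i' j' Xi Xj Xi' Xj' E => [b x] [c y] [b' x'] [c' y'].
  rewrite /XX /= => Xx Xy Xx' Xy' E; rewrite -E; case: ifPn => bc.
    move=> /(FI _ _ _ _ (FX _ _ Xx Xy) (nX _) (FX _ _ Xx' Xy') (nX _))[].
    by move=> /FI[] // -> -> /nI; case: b c b' c' {bc E} => [] [] [] [].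
  move=> /FI[] // -> ->; move: bc; rewrite E.
  by case: b c b' c' E => [] [] [] [].
set S' := [set t | _] in S'P domS'; exists S' => //.
split=> [[[x y] z] Sxyz|].
  have [Xx Xy _] := SX _ _ _ Sxyz.
  exists (false, x), (false, y); split=> //; congr (_, _, _).
  by apply: Sf Sxyz _; exact: FS.
move=> S'S; have [_] := hX _ (nX 0); apply.
have /S'S/SX[//] : S' (h (n 0), h (n 0), G (true, n 0) (true, n 0)).
by exists (true, n 0), (true, n 0); split=> //; exact: nX.
Qed.

(** Take a maximal pairing above one on a countable subset, with domain [X]. A copy of [X] outside
    [X] would allow an extension, so the rest of [A] embeds in [X]. Then [A] embeds in the square of
    [X], hence in [X], and so does its square. *)
Lemma infinite_card_setX (T : Type) (A : set T) : infinite_set A ->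
  A `*` A #<= A.
Proof.
move=> /[dup] /infinite_setN0 A0 /infiniteP /(card_le_injP A0)[n [nA nI']].
have nI : injective n by move=> i j; exact: nI'.
have [S0P domS0] := @is_pairing_graph T nat A setT n
  (fun i j => n (pickle (i, j))) (fun i _ => nA i I) (fun i j _ _ => nI i j)
  (fun i j _ _ => ex_intro2 _ _ (pickle (i, j)) I erefl)
  (fun i j i' j' _ _ _ _ E =>
    let: erefl := pcan_inj pickleK (nI _ _ E) in conj erefl erefl).
set S0 := [set t | _] in S0P domS0.
(* Joining [S0] inside the property, rather than asking [S] to contain it, keeps the empty chain
   admissible. *)
have [S [SP Smax]] := @Zorn_bigcup _ [set S | is_pairing A (S `|` S0)]
  (fun F FP Ftot => is_pairing_bigcup S0P FP Ftot).
move: SP => /=; set S1 := S `|` S0 => S1P.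
have nX i : graph_dom S1 (n i).
  have [z S0z] : graph_dom S0 (n i) by rewrite domS0; exists i.
  by exists z; right.
set X := graph_dom S1 in nX.
have X0 : X !=set0 by exists (n 0).
have [XA SX St Sf SI] := S1P.
have XX : X `*` X #<= X.
  have /choice[F FP] (t : T * T) : exists z, X t.1 -> X t.2 -> S1 (t.1, t.2, z).
    have [[Xx Xy]|nXX] := pselect (X t.1 /\ X t.2).
      by have [z Sz] := St _ _ Xx Xy; exists z.
    by exists (n 0) => Xx Xy; case: nXX.
  apply: (@card_le_inj _ _ _ _ F) => [[x y] [/= Xx Xy]|].
    by have [] := SX _ _ _ (FP (x, y) Xx Xy).
  move=> [x y] [x' y'] [/= Xx Xy] [/= Xx' Xy'] E.
  have := FP (x, y) Xx Xy; rewrite E /= => /SI /(_ (FP (x', y') Xx' Xy')).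
  by move=> [-> ->].
have [AX|XA'] := card_le_total (A `\` X) X.
  have [f [fX fI]] := card_le_injP X0 AX.
  have {}AX : A #<= X.
    apply: card_le_trans XX.
    (* The points [n 0] and [n 1] tag the two parts of [A]. *)
    pose r x := if x \in X then (n 0, x) else (n 1, f x).
    apply: (@card_le_inj _ _ _ _ r) => [x Ax|x y Ax Ay]; rewrite /r.
      case: ifPn => [/set_mem Xx|/negP nXx]; first by split=> //; exact: nX.
      split; [exact: nX|apply: fX; split=> // Xx].
      by apply: nXx; exact: mem_set.
    case: ifPn => xX; case: ifPn => yX //; case=> //.
    - by move=> /nI.
    - by move=> /nI.
    - by apply: fI; split=> // /mem_set;
        [rewrite (negbTE xX)|rewrite (negbTE yX)].
  have [g [gX gI]] := card_le_injP X0 AX.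
  apply: (@card_le_trans _ _ _ (X `*` X)).
    apply: (@card_le_inj _ _ _ _ (fun t => (g t.1, g t.2))).
      by move=> [x y] [/= Ax Ay]; split; exact: gX.
    by move=> [x y] [x' y'] [/= ? ?] [/= ? ?] [/gI-> // /gI ->].
  exact: card_le_trans XX (subset_card_le XA).
have [Z|/set0P AX0] := eqVneq (A `\` X) set0.
  by move: XA'; rewrite Z card_le0 => /eqP XE; case: X0 => x; rewrite XE.
have [h [hX hI]] := card_le_injP AX0 XA'.
have [S' S'P [S1S' S'S1]] := pairing_extend S1P nI nX hX hI.
exfalso; apply: (Smax S') => /=.
  split=> [t St'|S'S]; first by apply: S1S'; left.
  by apply: S'S1 => t /S'S St'; left.
suff -> : S' `|` S0 = S' by [].
by apply/setUidPl => t S0t; apply: S1S'; right.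
Qed.

Lemma card_setX_max (T U V : Type) (A : set T) (B : set U) (C : set V) :
  infinite_set C -> A #<= C -> B #<= C -> A `*` B #<= C.
Proof.
move=> Cinf AC BC; have C0 := infinite_setN0 Cinf.
have [f [fC fI]] := card_le_injP C0 AC; have [g [gC gI]] := card_le_injP C0 BC.
apply: card_le_trans (infinite_card_setX Cinf).
apply: (@card_le_inj _ _ _ _ (fun t => (f t.1, g t.2))).
  by move=> [x y] [/= Ax By]; split; [exact: fC|exact: gC].
by move=> [x y] [x' y'] [/= ? ?] [/= ? ?] [/fI-> // /gI ->].
Qed.

Lemma infinite_card_le (T U : Type) (A : set T) (B : set U) :
  infinite_set A -> A #<= B -> infinite_set B.
Proof. by move=> Ainf AB Bfin; apply: Ainf; exact: card_le_finite AB Bfin. Qed.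

Lemma cardinal_le_max_image (T U V : Type) (A : set T) (B : set U)
    (f : T -> U -> V) (C : set V) : infinite_set B ->
  C #<= [set f t.1 t.2 | t in A `*` B] ->
  cardinal_le (cardinal_of C)
    (cardinal_max (cardinal_of A) (cardinal_of B)).
Proof.
move=> Binf /card_le_trans/(_ (card_image_le _ _)) CAB.
rewrite /cardinal_max; case: asboolP => [/cardinal_leE AB|nAB];
  apply/cardinal_leE; apply: card_le_trans CAB _.
  exact: card_setX_max.
(* Here [cardinal_max] is its first argument by default; comparability shows that it is the larger
   one. *)
have BA : B #<= A.
  by have [/cardinal_leE|//] := card_le_total A B.
by apply: card_setX_max => //; exact: infinite_card_le BA.
Qed.

(** * The permutations *)

Lemma infinite_nat_ge (A : set nat) (m : nat) : infinite_set A ->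
  exists2 n, A n & m <= n.
Proof.
move=> Ainf; apply: contrapT => nA; apply: Ainf.
apply: (sub_finite_set _ (finite_II m)) => n An /=.
by rewrite ltnNge; apply/negP => mn; apply: nA; exists n.
Qed.

Lemma homo_ltn_ge (e : nat -> nat) : {homo e : m n / m < n} ->
  forall n, n <= e n.
Proof. by move=> eS; elim=> [//|n IH]; apply: leq_ltn_trans IH (eS _ _ _). Qed.

Lemma infinite_increasing_enum (A : set nat) : infinite_set A ->
  exists e, increasing_enum e A.
Proof.
move=> Ainf.
have /choice[nxt nxtP] (m : nat) :
    exists n, [/\ A n, m <= n & forall k, A k -> m <= k -> n <= k].
  have ex : exists n, `[< A n /\ m <= n >].
    by have [n An mn] := infinite_nat_ge m Ainf; exists n; apply/asboolP.
  have [n /asboolP[An mn] nmin] := ex_minnP ex.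
  by exists n; split=> // k Ak mk; apply: nmin; apply/asboolP.
pose e := fix e n := if n is n'.+1 then nxt (e n').+1 else nxt 0.
have eS : {homo e : m n / m < n}.
  apply: homo_ltn => [m n p|i]; first exact: ltn_trans.
  by have [] := nxtP (e i).+1.
exists e; split=> //; apply/seteqP; split=> [_ [[|n] _ <-]|a Aa].
- by have [] := nxtP 0.
- by have [] := nxtP (e n).+1.
(* At the least [n] with [a <= e n], the value [e n] is the least element of [A] past the previous
   value, so it cannot exceed [a]. *)
have ex : exists n, a <= e n by exists a; exact: homo_ltn_ge.
have [[|n] aen nmin] := ex_minnP ex.
  exists 0 => //=; apply/eqP; rewrite eqn_leq aen andbT.
  by have [_ _ ->] := nxtP 0.
exists n.+1 => //; apply/eqP; rewrite eqn_leq aen andbT.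
have [_ _ -> //] := nxtP (e n).+1.
by rewrite ltnNge; apply/negP => /nmin; rewrite ltnn.
Qed.

(** The increasing enumeration of [range key], pulled back along [key], lists all natural numbers by
    increasing key. *)
Lemma key_sort (key : nat -> nat) : injective key ->
  exists2 p, bijective p & {homo key \o p : m n / m < n}.
Proof.
move=> keyI.
have [|e [eS eE]] := @infinite_increasing_enum (range key).
  apply: infinite_card_le infinite_nat _.
  by apply: (@card_le_inj _ _ _ _ key) => [x _|x y _ _ /keyI//]; exists x.
have /choice[p pE] (n : nat) : exists m, key m = e n.
  by have [m _ <-] : range key (e n) by [rewrite -eE; exists n]; exists m.
have kpS : {homo key \o p : m n / m < n} by move=> m n mn /=; rewrite !pE eS.
exists p => //; rewrite -setTT_bijective; split=> // [m n _ _ pmn|m _].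
  by apply: (incn_inj (leq_mono kpS)); rewrite /= pmn.
have [n _ en] : range e (key m) by rewrite eE; exists m.
by exists n => //; apply: keyI; rewrite pE.
Qed.

(** The maximum stands in for monotonicity of [f], which members of the families need not have. *)
Fixpoint checkpoint (f : nat -> nat) (k : nat) : nat :=
  if k is k'.+1
  then (\max_(m < (checkpoint f k').+1) f m + checkpoint f k').+1 else 0.

Lemma checkpoint_homo f : {homo checkpoint f : m n / m < n}.
Proof.
apply: homo_ltn => [m n p|k] /=; first exact: ltn_trans.
by rewrite ltnS leq_addl.
Qed.

Lemma checkpoint_ltn f m n : (checkpoint f m < checkpoint f n) = (m < n).
Proof. exact: (leqW_mono (leq_mono (@checkpoint_homo f))). Qed.

Lemma checkpoint_bound f k m : m <= checkpoint f k -> f m < checkpoint f k.+1.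
Proof.
rewrite -ltnS => mk /=; rewrite ltnS.
apply: leq_trans (leq_addr _ _).
exact: (leq_bigmax (F := fun i : 'I_(checkpoint f k).+1 => f i) (Ordinal mk)).
Qed.

Lemma checkpoint_block f n :
  exists k, checkpoint f k <= n < checkpoint f k.+1.
Proof.
have ex : exists k, n < checkpoint f k.
  by exists n.+1; exact: homo_ltn_ge (@checkpoint_homo f) _.
have [[//|k] nk kmin] := ex_minnP ex.
by exists k; rewrite nk andbT leqNgt; apply/negP => /kmin; rewrite ltnn.
Qed.

(* Parity keeps the two kinds of keys apart, so [delay A f] is injective. *)
Definition delay (A : set nat) (f : nat -> nat) (j : nat) : nat :=
  if `[< A j >] then j.*2.+1 else (checkpoint f j).*2.

Lemma delay_inj A f : injective (delay A f).
Proof.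
move=> i j; rewrite /delay; case: ifP => _; case: ifP => _; do ?lia.
move=> ij; apply: (incn_inj (leq_mono (@checkpoint_homo f))); lia.
Qed.

Lemma delay_ge A f j : j <= delay A f j.
Proof.
rewrite /delay; case: ifP => _; first lia.
by have := homo_ltn_ge (@checkpoint_homo f) j; lia.
Qed.

Definition rearrangement A f : nat -> nat :=
  s2val (cid2 (key_sort (@delay_inj A f))).

Lemma rearrangement_bij A f : bijective (rearrangement A f).
Proof. exact: (s2valP (cid2 (key_sort (@delay_inj A f)))). Qed.

Lemma rearrangement_homo A f :
  {homo delay A f \o rearrangement A f : m n / m < n}.
Proof. exact: (s2valP' (cid2 (key_sort (@delay_inj A f)))). Qed.

(** * Unbounded and dominating families *)

Lemma le_starNP f g : ~ le_star f g ->
  forall m, exists2 n, m <= n & g n < f n.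
Proof.
move=> /infinite_nat_ge/[swap] m /(_ m)[n /negP fg mn].
by exists n => //; rewrite ltnNge.
Qed.

Lemma le_starP f g : le_star f g -> exists m, forall n, m <= n -> f n <= g n.
Proof.
move=> /finite_seqP[s sE]; exists (\max_(n <- s) n).+1 => n mn.
rewrite leqNgt; apply/negP => gf; have : [set` s] n.
  by rewrite -sE /= leqNgt gf.
by move=> /= /(leq_bigmax_seq (F := id))/(_ isT); rewrite leqNgt mn.
Qed.

Lemma dominating_unbounded D : dominating_family D -> unbounded_family D.
Proof.
move=> Ddom [g Dg]; have [f Df gf] := Ddom (fun n => (g n).+1).
have [m mP] := le_starP gf; have [m' m'P] := le_starP (Dg _ Df).
have := m'P (maxn m m') (leq_maxr _ _).
by rewrite leqNgt mP // leq_maxl.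
Qed.

(** A finite family is bounded by its pointwise maximum. *)
Lemma unbounded_infinite B : unbounded_family B -> infinite_set B.
Proof.
move=> Bunb /finite_seqP[s BE]; apply: Bunb.
exists (fun n => \max_(f <- s) f n) => f; rewrite BE /= => fs.
rewrite /le_star (_ : [set _ | _] = set0) //; apply/seteqP; split=> // n /=.
by apply; apply: (leq_bigmax_seq (F := fun f : nat -> nat => f n)).
Qed.

Lemma dominating_setT : dominating_family setT.
Proof.
move=> g; exists g => //; rewrite /le_star (_ : [set _ | _] = set0) //.
by apply/seteqP; split=> n //=; rewrite leqnn.
Qed.

(** * Subseries and rearrangements *)

Section series_enum.
Variable R : realType.
Implicit Types (a : R^nat) (A : set nat) (f : nat -> nat).
Local Open Scope ring_scope.

(** As [q] lists [A] by increasing key, the keys below [t] fill an initial segment, whose sum can be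
    reordered by index. The key is the identity for subseries and [delay] for rearrangements. *)
Lemma series_enumE a A (key q : nat -> nat) (t M : nat) :
  {homo key \o q : m n / (m < n)%N} -> range q = A ->
  (forall j, A j -> (key j < t)%N -> (j < M)%N) ->
  exists2 N, (forall i, (i < N)%N = (key (q i) < t)%N) &
    series (a \o q) N = \sum_(0 <= j < M | `[< A j >] && (key j < t)%N) a j.
Proof.
move=> kqS qA AM.
have ex : exists i, (t <= key (q i))%N by exists t; exact: (homo_ltn_ge kqS).
have [N tN Nmin] := ex_minnP ex.
have NP i : (i < N)%N = (key (q i) < t)%N.
  apply/idP/idP => [iN|it].
    by rewrite ltnNge; apply/negP => /Nmin; rewrite leqNgt iN.
  have := leq_trans it tN; rewrite ltnNge; apply: contraNT.
  by rewrite -leqNgt leq_eqVlt => /predU1P[->//|/kqS/ltnW].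
exists N => //.
have qI : injective q.
  by move=> i j ij; apply: (incn_inj (leq_mono kqS)); rewrite /= ij.
rewrite /series /= -(big_map q predT a) -big_filter -[RHS]big_filter.
apply: perm_big; apply: uniq_perm.
- by rewrite filter_uniq // map_inj_uniq // iota_uniq.
- by rewrite filter_uniq // iota_uniq.
move=> j; rewrite filter_predT mem_filter mem_index_iota /=.
apply/mapP/idP => [[i]|/andP[/andP[/asboolP Aj jt] _]].
  rewrite mem_index_iota /= NP => it ->.
  have Aq : A (q i) by rewrite -qA; exists i.
  by rewrite it AM // asboolT.
have [i _ ij] : range q j by rewrite qA.
by exists i => //; rewrite mem_index_iota /= NP ij.
Qed.

Definition sum_in a A (m : nat) : R := \sum_(0 <= j < m | `[< A j >]) a j.

Lemma series_subE a A e (m : nat) : increasing_enum e A ->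
  exists2 N, (forall i, (i < N)%N = (e i < m)%N) &
    series (a \o e) N = sum_in a A m.
Proof.
move=> [eS eA].
have [//|N NP sE] := @series_enumE a A id e m m eS eA.
exists N => //; rewrite sE /sum_in [in RHS]big_nat_cond [in LHS]big_nat_cond.
by apply: eq_bigl => j /=; case: (j < m)%N; rewrite ?andbF ?andbT.
Qed.

Lemma series_sub_comp a A e : increasing_enum e A ->
  series (a \o e) = sum_in a A \o e.
Proof.
move=> eA; apply/funext => N /=; have [N' N'P <-] := series_subE a (e N) eA.
congr (series _ _).
have N'E i : (i < N')%N = (i < N)%N.
  have eM := leqW_mono (leq_mono eA.1).
  by rewrite N'P eM.
by apply/eqP; rewrite eqn_leq leqNgt -N'E ltnn leqNgt N'E ltnn.
Qed.

(** Keys are odd on [A] and even off it, so the threshold [t] on keys becomes [t./2] for elements of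
    [A] and [uphalf t] for checkpoints. *)
Lemma series_rearrangementE a A f (t M : nat) : (t <= M)%N ->
  let p := rearrangement A f in
  exists2 N, (forall i, (i < N)%N = (delay A f (p i) < t)%N) &
    series (a \o p) N = sum_in a A t./2 +
      \sum_(0 <= j < M | ~~ `[< A j >] && (checkpoint f j < uphalf t)%N) a j.
Proof.
move=> tM p.
have rp : range p = setT.
  apply/seteqP; split=> // n _; have [q _ pK] := rearrangement_bij A f.
  by exists (q n).
have [|N NP sE] := @series_enumE a setT (delay A f) p t M
    (@rearrangement_homo A f) rp.
  move=> j _ jt; apply: leq_trans tM; apply: leq_ltn_trans jt.
  exact: delay_ge.
exists N => //; rewrite sE (bigID (fun j => `[< A j >])) /=; congr (_ + _).
  rewrite /sum_in [RHS](big_nat_widen _ _ M); last lia.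
  apply: eq_bigl => j; rewrite asboolT //= /delay.
  by case: ifP => _; rewrite ?andbF //= ?andbT; lia.
apply: eq_bigl => j; rewrite asboolT //= /delay.
by case: ifP => _; rewrite ?andbF //= ?andbT; lia.
Qed.

(** If for every [e] some [u m] stayed within [e] of all later terms, [u] would be Cauchy. So one
    [e] serves every left end [m], which yields the function [g] of [rearrangement_dvg]. *)
Lemma not_cvgn_osc (u : R^nat) : ~ cvgn u ->
  exists2 e, 0 < e & forall m, exists2 n, (m < n)%N & e <= `|u m - u n|.
Proof.
move=> nu; apply: contrapT => nosc; apply/nu/cauchy_cvgP/cauchy_exP => e e0.
apply: contrapT => nball; apply: nosc; exists e => // m.
apply: contrapT => nm; apply: nball; exists (u m); exists m => //= n mn.
rewrite /ball /= ltNge; apply/negP => emn; apply: nm; exists n => //.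
rewrite ltn_neqAle mn andbT; apply/eqP => E.
by move: emn; rewrite E subrr normr0 leNgt e0.
Qed.

Lemma cvgn_osc (u : R^nat) (e : R) : cvgn u -> 0 < e ->
  exists N, forall m n, (N <= m)%N -> (N <= n)%N -> `|u m - u n| < e.
Proof.
move=> /cvgrPdist_lt uc e0; have e2 : 0 < e / 2 by rewrite divr_gt0.
have [N _ NP] := uc _ e2; exists N => m n Nm Nn.
rewrite (splitr e) -(subrKA (limn u)); apply: le_lt_trans (ler_normD _ _) _.
by rewrite ltrD // ?[`|u m - _|]distrC; apply: NP.
Qed.

Lemma rearrangement_dvg a A : ~ cvgn (sum_in a A) ->
  exists g, forall f, ~ le_star f g ->
    ~ cvgn (series (a \o rearrangement A f)).
Proof.
move=> /not_cvgn_osc[e e0 /(_ _)/cid2-/all_sig2[g gS ge]].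
exists (g \o g) => f /le_starNP fg sc.
have [N0 N0P] := cvgn_osc sc e0; set p := rearrangement A f in sc N0P.
have cge k := homo_ltn_ge (@checkpoint_homo f) k.
(* A sum cut at a key threshold above [K] has more than [N0] terms. *)
pose K := (delay A f (p N0)).
have [n Kn gfn] := fg (checkpoint f K).
have [k /andP[kn nk]] := checkpoint_block f n.
have Kk : (K <= k)%N.
  by rewrite -ltnS -(checkpoint_ltn f); exact: leq_ltn_trans Kn nk.
have gk2 : (g (g n) < checkpoint f k.+2)%N.
  by apply: ltn_trans gfn _; apply: checkpoint_bound; exact: ltnW.
have [i [m [Ki im mi]]] : exists i m, [/\ (K <= i)%N,
    (checkpoint f i <= m)%N & (g m <= checkpoint f i.+1)%N].
  (* Of [n, g n) and [g n, g (g n)), at most one contains [checkpoint f k.+1]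
     in its interior. *)
  have [gn|ng] := leqP (g n) (checkpoint f k.+1); first by exists k, n.
  by exists k.+1, (g n); split; [lia|exact: ltnW|exact: ltnW].
have Km : (K <= m)%N by apply: leq_trans im; apply: leq_trans (cge i).
have mg := gS m.
(* The odd threshold counts a checkpoint equal to [m], the even one omits a checkpoint equal to
   [g m]. Both cuts thus list the same indices outside [A], and only the sums over [A] differ. *)
have [|N1 N1P s1] := @series_rearrangementE a A f m.*2.+1 (g m).*2; first lia.
have [|N2 N2P s2] := @series_rearrangementE a A f (g m).*2 (g m).*2; first lia.
have N01 : (N0 < N1)%N by rewrite N1P -/p -/K; lia.
have N02 : (N0 < N2)%N by rewrite N2P -/p -/K; lia.
have := N0P N1 N2 (ltnW N01) (ltnW N02); rewrite s1 s2 ltNge => /negP; apply.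
rewrite uphalf_double /= uphalf_double !doubleK.
rewrite (eq_bigl (fun j => ~~ `[< A j >] && (checkpoint f j < g m)%N)).
  by rewrite opprD addrACA subrr addr0 ge.
move=> j; congr (_ && _); apply/idP/idP => [jm|jm]; first lia.
rewrite ltnS; apply: leq_trans im; rewrite leqNgt checkpoint_ltn.
by rewrite -leqNgt -ltnS -(checkpoint_ltn f); exact: leq_trans jm mi.
Qed.

Lemma rearrangement_cvgry a A : sum_in a A @ \oo --> +oo ->
  exists g, forall f, le_star g f ->
    series (a \o rearrangement A f) @ \oo --> +oo.
Proof.
move=> /cvgryPge Soo.
(* While [t./2] lies between the checkpoints [k] and [k.+1], only indices up to [k] outside [A] have
   been listed; past [G k] the sum over [A] outweighs them by [k]. *)
have /choice[G GP] (k : nat) : exists m, forall n, (m <= n)%N ->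
    k%:R + \sum_(0 <= j < k.+1) `|a j| <= sum_in a A n.
  by have [m _ mP] := Soo (k%:R + \sum_(0 <= j < k.+1) `|a j|); exists m.
(* The shift is there because checkpoint [k] exceeds [f k.-1], which must bound [G k]. *)
exists (G \o S) => f /le_starP[K KP]; set p := rearrangement A f.
apply/cvgryPge => L; have [L' LL'] : exists k : nat, L <= k%:R.
  exists (Num.truncn L).+1; exact: ltW (truncnS_gt L).
pose k0 := maxn K.+1 L'.
exists (checkpoint f k0).*2 => // N /= kN.
have NdN : (N <= delay A f (p N))%N.
  exact: (homo_ltn_ge (@rearrangement_homo A f)).
set t := delay A f (p N) in NdN.
have [k /andP[kt tk]] := checkpoint_block f t./2.
have k0k : (k0 <= k)%N.
  by rewrite -ltnS -(checkpoint_ltn f); apply: leq_ltn_trans tk; lia.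
have [|N' N'P] := @series_rearrangementE a A f t (t + k.+1); first lia.
(* With the key of [p N] as threshold, exactly the first [N] terms are cut off. *)
have NN' : N = N'.
  have dM := leqW_mono (leq_mono (@rearrangement_homo A f)).
  apply/eqP; rewrite eqn_leq leqNgt (leqNgt N').
  by rewrite N'P -/p -/t ltnn -dM /= -/p -/t -N'P ltnn.
rewrite -NN' => ->.
have Gt : (G k <= t./2)%N.
  have kE : k = k.-1.+1 by lia.
  have Kk : (K <= k.-1)%N by lia.
  apply: leq_trans kt; rewrite kE; apply: leq_trans (KP _ Kk) _.
  apply/ltnW/checkpoint_bound/homo_ltn_ge; exact: checkpoint_homo.
have DB : - \sum_(0 <= j < k.+1) `|a j| <= \sum_(0 <= j < t + k.+1 |
    ~~ `[< A j >] && (checkpoint f j < uphalf t)%N) a j.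
  rewrite lerNl -sumrN [leRHS](big_nat_widen _ _ (t + k.+1)); last lia.
  rewrite [leLHS]big_mkcond [leRHS]big_mkcond /=; apply: ler_sum => j _.
  case: ifP => [/andP[_ jt]|_].
    rewrite ifT; last first.
      rewrite -(checkpoint_ltn f); apply: leq_ltn_trans tk; lia.
    by rewrite -normrN ler_norm.
  by case: ifP.
have := lerD (GP _ _ Gt) DB; rewrite addrK; apply: le_trans.
by apply: le_trans LL' _; rewrite ler_nat; lia.
Qed.

(** * From divergent subseries to families of rearrangements *)

Lemma increasing_enum_cvg e A : increasing_enum e A -> e @ \oo --> \oo.
Proof.
move=> [eS _] P [N _ NP]; exists N => // n /= Nn; apply: NP => /=.
exact: leq_trans Nn (homo_ltn_ge eS n).
Qed.

Lemma subseries_dvg_sum_in a A : subseries_dvg a A -> ~ cvgn (sum_in a A).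
Proof.
move=> [e eA nse] sc; apply: nse; rewrite (series_sub_comp a eA).
apply: (cvgP (limn (sum_in a A))).
exact: cvg_comp (increasing_enum_cvg eA) sc.
Qed.

Lemma subseries_cvgry a A e : increasing_enum e A ->
  (series (a \o e) @ \oo --> +oo) <-> (sum_in a A @ \oo --> +oo).
Proof.
move=> eA; split=> [/cvgryPge soo|Soo]; last first.
  rewrite (series_sub_comp a eA).
  exact: cvg_comp (increasing_enum_cvg eA) Soo.
apply/cvgryPge => L; have [N _ NP] := soo L; exists (e N).+1 => //= m eNm.
have [N' N'P <-] := series_subE a m eA; apply: NP => /=.
by apply: ltnW; rewrite N'P.
Qed.

Lemma dvg_infty_not_cvgn (u : R^nat) : dvg_infty u -> ~ cvgn u.
Proof.
move=> uoo /cvg_seq_bounded/pinfty_ex_gt0[M M0 uM].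
have {}uM n : `|u n| <= M by exact: uM.
case: uoo => [/cvgryPgt/(_ M)|/cvgrNyPlt/(_ (- M))] [N _ /(_ N (leqnn N))] /=.
  by rewrite ltNge (le_trans (ler_norm _) (uM N)).
by rewrite ltrNr ltNge (le_trans (ler_norm _)) // normrN.
Qed.

(** This ensures that the minima are attained. If the positive terms had a convergent sum, the sum
    of absolute values, being twice that sum minus the series, would converge too. *)
Lemma subseries_infty_family_setT : @subseries_infty_family R setT.
Proof.
move=> a [sa nsa]; pose A : set nat := [set j | 0 < a j]; exists A => //.
have nSA : ~ cvgn (sum_in a A).
  move=> SA; apply: nsa.
  have -> : [normed series a] = 2 *: (sum_in a A : R^nat) - series a.
    apply/funext => n.
    rewrite [RHS](_ : _ = 2 * sum_in a A n - series a n) //.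
    rewrite /sum_in /series /= big_mkcond mulr_sumr -sumrB.
    apply: eq_bigr => j _.
    case: asboolP => [aj|/negP]; first by rewrite gtr0_norm //; lra.
    by rewrite -leNgt => /ler0_norm ->; lra.
  by apply: is_cvgB => //; exact: is_cvgZr.
have SAoo : sum_in a A @ \oo --> +oo.
  apply: nondecreasing_dvgn_lt nSA.
  by apply: nondecreasing_series => n _ /asboolP /ltW.
(* For finite [A] the sums over [A] would be eventually constant, against their oscillation. *)
have [e eA] : exists e, increasing_enum e A.
  apply: infinite_increasing_enum => /finite_seqP[s sE].
  have [d d0 /(_ (\max_(j <- s) j).+1)[n sn]] := not_cvgn_osc nSA.
  rewrite leNgt => /negP; apply.
  rewrite distrC /sum_in (big_cat_nat (leq0n _) (ltnW sn)) /=.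
  rewrite addrAC subrr add0r.
  rewrite big_nat_cond big1 ?normr0 // => j /andP[/andP[sj _] /asboolP].
  rewrite sE /= => /(leq_bigmax_seq (F := id))/(_ isT).
  by rewrite leqNgt sj.
by exists e => //; left; apply/(subseries_cvgry a eA).
Qed.

Lemma subseries_infty_familyW (F : set (set nat)) :
  subseries_infty_family R F -> subseries_family R F.
Proof.
move=> FP a /FP[A FA [e eA /dvg_infty_not_cvgn nse]].
by exists A => //; exists e.
Qed.

(* Here and below [set nat] is unfolded to [nat -> Prop]: [set nat] lives in the
   universe of the argument of [set], which is too large for [min_cardP]. *)
Lemma rearrangement_family_image (F : set (nat -> Prop))
    (B : set (nat -> nat)) :
  subseries_family R F -> unbounded_family B ->
  rearrangement_family R [set rearrangement t.1 t.2 | t in F `*` B].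
Proof.
move=> FP Bunb; split=> [_ [[A f] _ <-]|a /FP[A FA /subseries_dvg_sum_in]].
  exact: rearrangement_bij.
move=> /rearrangement_dvg[g gP].
have [f Bf fg] : exists2 f, B f & ~ le_star f g.
  apply: contrapT => nf; apply: Bunb; exists g => f Bf; apply: contrapT => fg.
  by apply: nf; exists f.
exists (rearrangement A f); first by exists (A, f).
by move=> /cvgP; exact: gP.
Qed.

Lemma rearrangement_infty_family_image (F : set (nat -> Prop))
    (D : set (nat -> nat)) :
  subseries_infty_family R F -> dominating_family D ->
  rearrangement_infty_family R [set rearrangement t.1 t.2 | t in F `*` D].
Proof.
move=> FP Ddom; split=> [_ [[A f] _ <-]|a /FP[A FA [e eA]]].
  exact: rearrangement_bij.
case=> [/(subseries_cvgry a eA)|aoo].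
  move=> /rearrangement_cvgry[g gP]; have [f Df gf] := Ddom g.
  by exists (rearrangement A f); [exists (A, f)|left; exact: gP].
(* Divergence to [-oo] is reduced to [+oo] by negating the series. *)
have /(subseries_cvgry _ eA)/rearrangement_cvgry[g gP] :
    series (- a \o e) @ \oo --> +oo.
  by rewrite (seriesN (a \o e)); apply/cvgNry.
have [f Df gf] := Ddom g.
exists (rearrangement A f); [by exists (A, f)|right].
apply/cvgNry; rewrite -seriesN; exact: gP.
Qed.

End series_enum.

Theorem theorem19 (R : realType) :
  cardinal_le (rearrangement_number R)
    (cardinal_max (subseries_number R) bounding_number) /\
  cardinal_le (rearrangement_number_infty R)
    (cardinal_max (subseries_number_infty R) dominating_number).
Proof.
have D0 : dominating_family !=set0 by exists setT; exact: dominating_setT.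
have B0 : unbounded_family !=set0.
  by exists setT; exact/dominating_unbounded/dominating_setT.
have SI0 : subseries_infty_family R !=set0.
  by exists setT; exact: subseries_infty_family_setT.
have S0 : subseries_family R !=set0.
  by exists setT; exact/subseries_infty_familyW/subseries_infty_family_setT.
split.
  have [F [FP sE _]] := @min_cardP (nat -> Prop) _ S0.
  have [B [BP bE _]] := min_cardP B0.
  have CP := rearrangement_family_image FP BP.
  have C0 : rearrangement_family R !=set0.
    by exists [set rearrangement t.1 t.2 | t in F `*` B].
  have [C [_ rE Cmin]] := min_cardP C0.
  rewrite /rearrangement_number /subseries_number /bounding_number rE sE bE.
  have Binf := unbounded_infinite BP.
  exact: (@cardinal_le_max_image (nat -> Prop)) Binf (Cmin _ CP).
have [F [FP sE _]] := @min_cardP (nat -> Prop) _ SI0.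
have [D [DP dE _]] := min_cardP D0.
have CP := rearrangement_infty_family_image FP DP.
have C0 : rearrangement_infty_family R !=set0.
  by exists [set rearrangement t.1 t.2 | t in F `*` D].
have [C [_ rE Cmin]] := min_cardP C0.
rewrite /rearrangement_number_infty /subseries_number_infty /dominating_number.
rewrite rE sE dE; have Dinf := unbounded_infinite (dominating_unbounded DP).
exact: (@cardinal_le_max_image (nat -> Prop)) Dinf (Cmin _ CP).
Qed.
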